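(* Given a dataset with $n$ samples and $m$ features, the time complexity required to build a Learning Hyperplane Tree (LHT) up to a maximum depth $d$ is $O(mnd)$.
   Context: **Learning Hyperplane Tree (LHT).** An LHT is an oblique decision tree for a binary classification problem. Each of the $n$ samples $\boldsymbol{x}_j\in\mathbb{R}^m$ has a label $p_j\in\{0,1\}$ (target $=1$, non-target $=0$). Parameters are $\alpha\ge 0$, $0\le\beta\le 1$, $\gamma>0$ (minimum number of samples for generating a pure leaf), and a minimum sample count. The tree is built recursively, starting from a root node (block) that holds all $n$ samples. A node is made a leaf if all its samples have the same label or if it has fewer samples than the minimum count. Otherwise it is a branching node and is split as follows, where $\mathbb{E}$ denotes a sample mean over the samples in the node. 1. *Feature selection.* For each feature $i$ compute $\mathbb{E}[X_i]$ and $\mathbb{E}[X_i^2]$, and the means $\mathbb{E}[X_i^{\mathrm{t}}]$, $\mathbb{E}[X_i^{\mathrm{nt}}]$ over the node's target and non-target samples. Retain features with $\mathbb{E}[X_i^2]-(\mathbb{E}[X_i])^2>\alpha$. Put $\mathrm{SD}_i=\mathbb{E}[X_i^{\mathrm{t}}]-\mathbb{E}[X_i^{\mathrm{nt}}]$, $\overline{\mathrm{SD}}=\max_i|\mathrm{SD}_i|$, $w_i=\mathrm{SD}_i/\overline{\mathrm{SD}}$, and select the features with $|w_i|\ge\beta$. 2. *Feature-weighted sums.* For each sample in the node compute $\mathrm{FS}(\boldsymbol{x}_j)=\sum_i w_i x_{ij}$, using the selected features and their weights. 3. *Threshold.* Let $\min\mathrm{TFS},\max\mathrm{TFS}$ be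 the minimum and maximum of $\mathrm{FS}$ over the node's target samples, and $\min\mathrm{NFS},\max\mathrm{NFS}$ those over its non-target samples. Let $e=(\min\mathrm{NFS}+\max\mathrm{NFS}+\min\mathrm{TFS}+\max\mathrm{TFS})/4$. Let $N_1$ (resp. $N_2$) be the number of target samples with $\mathrm{FS}<\min\mathrm{NFS}$ (resp. $\mathrm{FS}>\max\mathrm{NFS}$), let $N_3$ (resp. $N_4$) be the number of non-target samples with $\mathrm{FS}<\min\mathrm{TFS}$ (resp. $\mathrm{FS}>\max\mathrm{TFS}$), and let $N_{\max}=\max\{N_1,N_2,N_3,N_4\}$. If $N_{\max}\ge\gamma$, the threshold $c$ is $\min\mathrm{NFS}$ if $N_1=N_{\max}$, $\max\mathrm{NFS}+\delta_1$ if $N_2=N_{\max}$, $\min\mathrm{TFS}$ if $N_3=N_{\max}$, and $\max\mathrm{TFS}+\delta_1$ if $N_4=N_{\max}$, where $\delta_1>0$ is an infinitesimally small positive number. If $N_{\max}<\gamma$, then $c=e$. 4. *Partition.* Samples with $\mathrm{FS}(\boldsymbol{x}_j)<c$ go to the left child and samples with $\mathrm{FS}(\boldsymbol{x}_j)\ge c$ to the right child; the procedure is then applied to each child. The time counted is that of steps 1–4 over all nodes that are split, on the $d$ levels $0,1,\dots,d-1$ of the tree. (The fitting of a prediction function at each leaf is not part of this count.) *)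

(* Defs.v *)
From mathcomp Require Import all_boot all_order all_algebra.

Set Implicit Arguments.
Unset Strict Implicit.
Unset Printing Implicit Defensive.

Import Order.TTheory GRing.Theory Num.Theory.
Local Open Scope ring_scope.

(* [gamma] is the minimum number of samples for a pure leaf.  [delta1] stands
   for the infinitesimal shift of the threshold: on given data, every small
   enough positive number behaves as an infinitesimal one, namely
   x < y + delta1 iff x <= y for all the values x, y that get compared. *)
Record lht_params (R : realFieldType) := LhtParams {
  alpha : R;
  beta : R;
  gamma : R;
  delta1 : R;
  min_count : nat }.

(* [Branch ws c l r] splits on the hyperplane \sum_((i, w) <- ws) w * x_i = c:
   strictly below c goes to l, the rest to r. *)
Inductive tree (R : realFieldType) (n m : nat) :=
  | Leaf of seq 'I_n
  | Branch of seq ('I_m * R) & R & tree R n m & tree R n m.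

Arguments Leaf {R n m} _.

(* Row j of X is the sample x_j, and p j means that its label is 1 (target).
   A node is the list of the indices of its samples. *)

Section Tree.

Variables (R : realFieldType) (n m : nat) (P : lht_params R).
Variables (X : 'M[R]_(n, m)) (p : 'I_n -> bool).
Implicit Types (s : seq 'I_n) (i : 'I_m) (j : 'I_n) (v : seq R).

Definition targets s := [seq j <- s | p j].
Definition nontargets s := [seq j <- s | ~~ p j].

Definition is_leaf s := constant (map p s) || (size s < min_count P)%N.

Definition mean s (f : 'I_n -> R) : R := (\sum_(j <- s) f j) / (size s)%:R.

Definition variance s i : R :=
  mean s (fun j => X j i ^+ 2) - mean s (fun j => X j i) ^+ 2.

Definition SD s i : R :=
  mean (targets s) (fun j => X j i) - mean (nontargets s) (fun j => X j i).

Definition retained s : seq 'I_m :=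
  [seq i <- enum 'I_m | alpha P < variance s i].

(* The maximum of nonnegative numbers; it is 0 if no feature is retained. *)
Definition SDmax s : R := \big[Num.max/0]_(i <- retained s) `|SD s i|.

(* x / 0 = 0: all the weights are 0 if SDmax s = 0. *)
Definition weight s i : R := SD s i / SDmax s.

Definition selected s : seq 'I_m :=
  [seq i <- retained s | beta P <= `|weight s i|].

Definition FS s j : R := \sum_(i <- selected s) weight s i * X j i.

(* Only used on nonempty lists: a branching node has samples of both labels. *)
Definition seqmin v : R := foldr Num.min (head 0 v) v.
Definition seqmax v : R := foldr Num.max (head 0 v) v.

(* If several of the N_k equal Nmax, the first one decides. *)
Definition threshold s : R :=
  let tfs := [seq FS s j | j <- targets s] in
  let nfs := [seq FS s j | j <- nontargets s] in
  let N1 := count (fun x => x < seqmin nfs) tfs in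
  let N2 := count (fun x => seqmax nfs < x) tfs in
  let N3 := count (fun x => x < seqmin tfs) nfs in
  let N4 := count (fun x => seqmax tfs < x) nfs in
  let Nmax := maxn (maxn N1 N2) (maxn N3 N4) in
  if gamma P <= Nmax%:R then
    if N1 == Nmax then seqmin nfs
    else if N2 == Nmax then seqmax nfs + delta1 P
    else if N3 == Nmax then seqmin tfs
    else seqmax tfs + delta1 P
  else (seqmin nfs + seqmax nfs + seqmin tfs + seqmax tfs) / 4%:R.

(* Levels 0, ..., d - 1 may be split; the nodes of level d are leaves. *)
Fixpoint lht_from (d : nat) s : tree R n m :=
  if d is d'.+1 then
    if is_leaf s then Leaf s
    else Branch [seq (i, weight s i) | i <- selected s] (threshold s)
           (lht_from d' [seq j <- s | FS s j < threshold s])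
           (lht_from d' [seq j <- s | threshold s <= FS s j])
  else Leaf s.

Definition lht (d : nat) : tree R n m := lht_from d (enum 'I_n).

End Tree.

(* Time is that of a unit-cost machine on exact numbers: [tick a] performs one
   elementary operation, whose outcome is a.  Below, its argument is always one
   operation on operands that are already available: an arithmetic operation,
   a comparison or a min/max, an integer-to-number conversion, the reading of
   an entry of X or p, a negation, or an access to or the construction of one
   list cell. *)
Record timed (A : Type) := Timed { result : A; time : nat }.

Definition ret A (a : A) : timed A := Timed a 0.
Definition tick A (a : A) : timed A := Timed a 1.
Definition bind A B (t : timed A) (k : A -> timed B) : timed B :=
  Timed (result (k (result t))) (time t + time (k (result t)))%N.

Notation "'let!' x ':=' t 'in' k" := (bind t (fun x => k))
  (at level 200, x name, t at level 200, k at level 200, right associativity).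

(* Each iteration costs one operation (for the list access), plus the body. *)
Fixpoint tfoldr A B (f : A -> B -> timed B) (b0 : B) (s : seq A) : timed B :=
  if s is x :: s' then
    let! b := tfoldr f b0 s' in
    let! y := tick x in
    f y b
  else tick b0.

Definition tmap A B (f : A -> timed B) (s : seq A) : timed (seq B) :=
  tfoldr (fun x r => let! y := f x in tick (y :: r)) [::] s.

Definition tfilter A (a : A -> timed bool) (s : seq A) : timed (seq A) :=
  tfoldr (fun x r => let! b := a x in if b then tick (x :: r) else ret r) [::] s.

Definition tcount A (a : A -> timed bool) (s : seq A) : timed nat :=
  tfoldr (fun x k => let! b := a x in if b then tick k.+1 else ret k) 0%N s.

Definition tlength A (s : seq A) : timed nat :=
  tfoldr (fun _ k => tick k.+1) 0%N s.

Definition tsum (R : realFieldType) A (f : A -> timed R) (s : seq A) : timed R :=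
  tfoldr (fun x r => let! y := f x in tick (y + r)) 0 s.

Definition tmin (R : realFieldType) (v : seq R) : timed R :=
  let! x0 := tick (head 0 v) in tfoldr (fun x r => tick (Num.min x r)) x0 v.

Definition tmax (R : realFieldType) (v : seq R) : timed R :=
  let! x0 := tick (head 0 v) in tfoldr (fun x r => tick (Num.max x r)) x0 v.

Section Build.

Variables (R : realFieldType) (n m : nat) (P : lht_params R).
Variables (X : 'M[R]_(n, m)) (p : 'I_n -> bool).
Implicit Types (s : seq 'I_n) (i : 'I_m) (j : 'I_n).

Definition tmean (f : 'I_n -> timed R) s : timed R :=
  let! S := tsum f s in
  let! k := tlength s in
  let! r := tick k%:R in
  tick (S / r).

(* (i, variance of feature i, SD_i); t and u are the target and the non-target
   samples of s *)
Definition feature_stats s t u i : timed ('I_m * R * R) :=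
  let! e1 := tmean (fun j => tick (X j i)) s in
  let! e2 := tmean (fun j => let! x := tick (X j i) in tick (x * x)) s in
  let! et := tmean (fun j => tick (X j i)) t in
  let! eu := tmean (fun j => tick (X j i)) u in
  let! e11 := tick (e1 * e1) in
  let! v := tick (e2 - e11) in
  let! sd := tick (et - eu) in
  ret (i, v, sd).

Definition select_features s : timed (seq ('I_m * R)) :=
  let! t := tfilter (fun j => tick (p j)) s in
  let! u := tfilter (fun j => let! b := tick (p j) in tick (~~ b)) s in
  let! stats := tmap (feature_stats s t u) (enum 'I_m) in
  let! kept := tfilter (fun z => tick (alpha P < z.1.2)) stats in
  let! M := tfoldr (fun z r => let! a := tick `|z.2| in tick (Num.max a r))
              0 kept in
  let! ws := tmap (fun z => let! w := tick (z.2 / M) in ret (z.1.1, w)) kept in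
  tfilter (fun z => let! a := tick `|z.2| in tick (beta P <= a)) ws.

Definition weighted_sums (ws : seq ('I_m * R)) s : timed (seq ('I_n * R)) :=
  tmap (fun j =>
    let! y := tsum (fun z => let! x := tick (X j z.1) in tick (z.2 * x)) ws in
    ret (j, y)) s.

Definition find_threshold (fs : seq ('I_n * R)) : timed R :=
  let! t := tfilter (fun z => tick (p z.1)) fs in
  let! u := tfilter (fun z => let! b := tick (p z.1) in tick (~~ b)) fs in
  let! tfs := tmap (fun z => ret z.2) t in
  let! nfs := tmap (fun z => ret z.2) u in
  let! minT := tmin tfs in
  let! maxT := tmax tfs in
  let! minN := tmin nfs in
  let! maxN := tmax nfs in
  let! N1 := tcount (fun x => tick (x < minN)) tfs in
  let! N2 := tcount (fun x => tick (maxN < x)) tfs in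
  let! N3 := tcount (fun x => tick (x < minT)) nfs in
  let! N4 := tcount (fun x => tick (maxT < x)) nfs in
  let! N12 := tick (maxn N1 N2) in
  let! N34 := tick (maxn N3 N4) in
  let! Nmax := tick (maxn N12 N34) in
  let! r := tick Nmax%:R in
  let! large := tick (gamma P <= r) in
  if large then
    let! b1 := tick (N1 == Nmax) in
    if b1 then ret minN else
    let! b2 := tick (N2 == Nmax) in
    if b2 then tick (maxN + delta1 P) else
    let! b3 := tick (N3 == Nmax) in
    if b3 then ret minT else tick (maxT + delta1 P)
  else
    let! a := tick (minN + maxN) in
    let! b := tick (a + minT) in
    let! e := tick (b + maxT) in
    tick (e / 4%:R).

Definition partition_node (fs : seq ('I_n * R)) (c : R) :
    timed (seq 'I_n * seq 'I_n) :=
  let! fl := tfilter (fun z => tick (z.2 < c)) fs in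
  let! fr := tfilter (fun z => tick (c <= z.2)) fs in
  let! l := tmap (fun z => ret z.1) fl in
  let! r := tmap (fun z => ret z.1) fr in
  ret (l, r).

(* What is timed is the computation of the features and weights, of the sums
   FS, of the threshold and of the partition: neither the leaf test nor the
   allocation of the nodes of the tree is. *)
Fixpoint build_from (d : nat) s : timed (tree R n m) :=
  if d is d'.+1 then
    if is_leaf P p s then ret (Leaf s) else
    let! ws := select_features s in
    let! fs := weighted_sums ws s in
    let! c := find_threshold fs in
    let! lr := partition_node fs c in
    let! tl := build_from d' lr.1 in
    let! tr := build_from d' lr.2 in
    ret (Branch ws c tl tr)
  else ret (Leaf s).

Definition build (d : nat) : timed (tree R n m) := build_from d (enum 'I_n).

End Build.

(* Main.v *)
(** Splitting a node with k samples costs O(mk + m + k).  A split node is not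
    empty and m > 0, so this is at most 147 mk.  The two children partition the
    samples of their parent, so the nodes of one level hold at most n samples
    in total; summing over the d levels gives O(mnd). *)

Require Import Defs.
From mathcomp Require Import all_boot all_order all_algebra.
From mathcomp Require Import zify.

Import Order.TTheory GRing.Theory Num.Theory.

Local Open Scope ring_scope.

Set Implicit Arguments.
Unset Strict Implicit.

(** * Results and costs of the timed list operations *)

Lemma result_tfoldr A B (f : A -> B -> timed B) b0 s :
  result (tfoldr f b0 s) = foldr (fun x b => result (f x b)) b0 s.
Proof. by elim: s => //= x s ->. Qed.

(** Each cell costs one unit besides the body, and the final empty list one more. Bounding the
    length by [k] lets a sublist be charged at the size of the node it comes from. *)
Lemma time_tfoldr A B c k (f : A -> B -> timed B) b0 s :
  (forall x b, time (f x b) <= c)%N -> (size s <= k)%N ->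
  (time (tfoldr f b0 s) <= 1 + c.+1 * k)%N.
Proof.
move=> fc; elim: s k => // x s IHs [|k] //= /IHs.
by have := fc x (result (tfoldr f b0 s)); lia.
Qed.

(** The continuation is measured only at the actual result of [t], so [b] may rely on what is known
    of that result, such as its length. *)
Lemma time_bind A B a b (t : timed A) (k : A -> timed B) :
  (time t <= a -> time (k (result t)) <= b -> time (bind t k) <= a + b)%N.
Proof. exact: leq_add. Qed.

Lemma result_bind A B (t : timed A) (k : A -> timed B) :
  result (bind t k) = result (k (result t)).
Proof. by []. Qed.

Section Timed.

Variables A B : Type.

Lemma result_tmap (f : A -> timed B) s :
  result (tmap f s) = [seq result (f x) | x <- s].
Proof. by rewrite /tmap result_tfoldr; elim: s => //= x s ->. Qed.

Lemma time_tmap c k (f : A -> timed B) s :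
  (forall x, time (f x) <= c)%N -> (size s <= k)%N ->
  (time (tmap f s) <= 1 + c.+2 * k)%N.
Proof.
by move=> fc sk; apply: (@time_tfoldr _ _ c.+1) => // x b; rewrite /= addn1 ltnS.
Qed.

Lemma result_tfilter (a : A -> timed bool) s :
  result (tfilter a s) = [seq x <- s | result (a x)].
Proof.
by rewrite /tfilter result_tfoldr; elim: s => //= x s ->; case: (result (a x)).
Qed.

Lemma time_tfilter c k (a : A -> timed bool) s :
  (forall x, time (a x) <= c)%N -> (size s <= k)%N ->
  (time (tfilter a s) <= 1 + c.+2 * k)%N.
Proof.
move=> ac sk; apply: (@time_tfoldr _ _ c.+1) => // x b /=.
by have := ac x; case: (result (a x)) => /=; lia.
Qed.

Lemma result_tcount (a : A -> timed bool) s :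
  result (tcount a s) = count (fun x => result (a x)) s.
Proof.
by rewrite /tcount result_tfoldr; elim: s => //= x s ->; case: (result (a x)).
Qed.

Lemma time_tcount c k (a : A -> timed bool) s :
  (forall x, time (a x) <= c)%N -> (size s <= k)%N ->
  (time (tcount a s) <= 1 + c.+2 * k)%N.
Proof.
move=> ac sk; apply: (@time_tfoldr _ _ c.+1) => // x b /=.
by have := ac x; case: (result (a x)) => /=; lia.
Qed.

Lemma result_tlength (s : seq A) : result (tlength s) = size s.
Proof. by rewrite /tlength result_tfoldr; elim: s => //= x s ->. Qed.

Lemma time_tlength k (s : seq A) :
  (size s <= k)%N -> (time (tlength s) <= 1 + 2 * k)%N.
Proof. exact: time_tfoldr. Qed.

Variable R : realFieldType.

Lemma result_tsum (f : A -> timed R) s :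
  result (tsum f s) = \sum_(x <- s) result (f x).
Proof.
rewrite /tsum result_tfoldr; elim: s => [|x s IHs] /=; first by rewrite big_nil.
by rewrite IHs big_cons.
Qed.

Lemma time_tsum c k (f : A -> timed R) s :
  (forall x, time (f x) <= c)%N -> (size s <= k)%N ->
  (time (tsum f s) <= 1 + c.+2 * k)%N.
Proof.
by move=> fc sk; apply: (@time_tfoldr _ _ c.+1) => // x b; rewrite /= addn1 ltnS.
Qed.

Lemma result_tmin (v : seq R) : result (tmin v) = seqmin v.
Proof. by rewrite /= result_tfoldr. Qed.

Lemma time_tmin k (v : seq R) :
  (size v <= k)%N -> (time (tmin v) <= 2 + 2 * k)%N.
Proof.
by move=> vk; apply: (@time_bind _ _ 1 (1 + 2 * k)) => //; apply: time_tfoldr.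
Qed.

Lemma result_tmax (v : seq R) : result (tmax v) = seqmax v.
Proof. by rewrite /= result_tfoldr. Qed.

Lemma time_tmax k (v : seq R) :
  (size v <= k)%N -> (time (tmax v) <= 2 + 2 * k)%N.
Proof.
by move=> vk; apply: (@time_bind _ _ 1 (1 + 2 * k)) => //; apply: time_tfoldr.
Qed.

End Timed.

(** * Correctness and cost of each step at one node *)

Section Build.

Variables (R : realFieldType) (n m : nat) (P : lht_params R).
Variables (X : 'M[R]_(n, m)) (p : 'I_n -> bool).
Implicit Types (s t u : seq 'I_n) (i : 'I_m) (j : 'I_n).

Lemma time_tmean c k (f : 'I_n -> timed R) s :
  (forall j, time (f j) <= c)%N -> (size s <= k)%N ->
  (time (tmean f s) <= 4 + (c + 4) * k)%N.
Proof.
move=> fc sk; have := time_tsum fc sk; have := time_tlength sk.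
by rewrite /tmean /=; lia.
Qed.

Lemma result_feature_stats s i :
  result (feature_stats X s (targets p s) (nontargets p s) i) =
  (i, variance X s i, SD X p s i).
Proof.
rewrite /feature_stats /= !result_tsum !result_tlength.
rewrite /variance /SD /mean expr2.
(* The preceding [expr2] only reaches the squared mean; the squares of entries are under the
   summation binder. *)
by under [in LHS]eq_bigr do rewrite /= -expr2.
Qed.

(** Three means cost [4 + 5 * k] each, the mean of squares costs [4 + 6 * k], and three operations
    follow. *)
Lemma time_feature_stats k s t u i :
  (size s <= k)%N -> (size t <= k)%N -> (size u <= k)%N ->
  (time (feature_stats X s t u i) <= 19 + 21 * k)%N.
Proof.
move=> sk tk uk.
have e1 r := @time_tmean 1 k (fun j => tick (X j i)) r (fun=> isT).
have e2 := @time_tmean 2 k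
  (fun j => let! x := tick (X j i) in tick (x * x)) s (fun=> isT) sk.
move: (e1 s sk) (e1 t tk) (e1 u uk) e2.
by rewrite /feature_stats /=; lia.
Qed.

Lemma result_select_features s :
  result (select_features P X p s) =
  [seq (i, weight P X p s i) | i <- selected P X p s].
Proof.
rewrite /select_features /= !result_tfilter /= !result_tmap /=.
rewrite (eq_map (result_feature_stats s)).
(* The test reads only the stored variance, so filtering commutes with attaching the statistics. *)
have -> : [seq z <- [seq (i, variance X s i, SD X p s i) | i <- enum 'I_m]
             | alpha P < z.1.2] =
    [seq (i, variance X s i, SD X p s i) | i <- retained P X s].
  by rewrite (filter_map _ _ (enum 'I_m)).
rewrite result_tfoldr (_ : foldr _ _ _ = SDmax P X p s).
  by rewrite -map_comp (filter_map _ _ (retained P X s)).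
(* Unlocking the big operator exposes it as a right fold, which is the shape of the timed
   maximum. *)
by rewrite /SDmax unlock; elim: (retained P X s) => //= i r ->.
Qed.

Lemma size_selected s : (size (selected P X p s) <= m)%N.
Proof.
rewrite -[X in (_ <= X)%N](size_enum_ord m) /selected /retained -filter_predI.
by rewrite size_filter count_size.
Qed.

Lemma time_select_features s :
  (time (select_features P X p s)
   <= 7 + 7 * size s + 34 * m + 21 * (m * size s))%N.
Proof.
set k := size s.
(* One summand per pass, in program order. Only the statistics, computed over the node for each of
   the [m] features, give a product [m * k]. *)
apply: (@leq_trans ((1 + 3 * k) + ((1 + 4 * k) + ((1 + (19 + 21 * k).+2 * m) +
  ((1 + 3 * m) + ((1 + 3 * m) + ((1 + 3 * m) + (1 + 4 * m)))))))%N); last by lia.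
apply: time_bind; first exact: time_tfilter.
apply: time_bind; first exact: time_tfilter.
rewrite !result_tfilter; apply: time_bind.
  apply: time_tmap => [i|]; last by rewrite size_enum_ord.
  by apply: time_feature_stats => //; rewrite size_filter count_size.
rewrite result_tmap; set stats := map _ _.
have stats_m : (size stats <= m)%N by rewrite size_map size_enum_ord.
apply: time_bind; first exact: time_tfilter.
rewrite result_tfilter; set kept := filter _ _.
have kept_m : (size kept <= m)%N.
  by apply: leq_trans stats_m; rewrite size_filter count_size.
apply: time_bind; first exact: time_tfoldr.
apply: time_bind; first exact: (@time_tmap _ _ 1).
by apply: (@time_tfilter _ 2); rewrite // result_tmap size_map.
Qed.

Lemma result_weighted_sums s :
  result (weighted_sums X [seq (i, weight P X p s i) | i <- selected P X p s] s)
  = [seq (j, FS P X p s j) | j <- s].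
Proof.
rewrite result_tmap; apply: eq_map => j /=.
by rewrite result_tsum big_map.
Qed.

Lemma time_weighted_sums ws s : (size ws <= m)%N ->
  (time (weighted_sums X ws s) <= 1 + (4 * m + 3) * size s)%N.
Proof.
(* The factor [4 * m + 3] is the cost [1 + 4 * m] of one sum plus the two units that mapping adds
   per sample. *)
move=> ws_m; rewrite addn3; apply: time_tmap => // j /=.
by rewrite addn0; apply: (@time_tsum _ _ 2).
Qed.

Lemma result_find_threshold s :
  result (find_threshold P p [seq (j, FS P X p s j) | j <- s]) =
  threshold P X p s.
Proof.
rewrite /find_threshold /threshold.
(* Labels depend only on the sample index, so splitting the pairs by label amounts to splitting [s]
   first. *)
do 2!rewrite result_bind result_tfilter filter_map.
do 2!rewrite result_bind result_tmap -map_comp.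
do 2!rewrite result_bind result_tmin result_bind result_tmax.
do 4!rewrite result_bind result_tcount.
by rewrite /=; do 4?case: ifP => //= _.
Qed.

Lemma time_find_threshold (fs : seq ('I_n * R)) :
  (time (find_threshold P p fs) <= 25 + 31 * size fs)%N.
Proof.
set k := size fs.
(* The final 9 covers what follows the counts: five operations up to the test against [gamma], then
   at most four in either branch. *)
apply: (@leq_trans ((1 + 3 * k) + ((1 + 4 * k) + ((1 + 2 * k) + ((1 + 2 * k) +
  ((2 + 2 * k) + ((2 + 2 * k) + ((2 + 2 * k) + ((2 + 2 * k) +
  ((1 + 3 * k) + ((1 + 3 * k) + ((1 + 3 * k) + ((1 + 3 * k) + 9))))))))))))%N);
  last by lia.
apply: time_bind; first exact: time_tfilter.
apply: time_bind; first exact: time_tfilter.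
rewrite !result_tfilter; set t := filter _ _; set u := filter _ _.
have t_k : (size t <= k)%N by rewrite size_filter count_size.
have u_k : (size u <= k)%N by rewrite size_filter count_size.
apply: time_bind; first exact: time_tmap.
apply: time_bind; first exact: time_tmap.
rewrite !result_tmap; set tfs := map _ _; set nfs := map _ _.
have tfs_k : (size tfs <= k)%N by rewrite size_map.
have nfs_k : (size nfs <= k)%N by rewrite size_map.
apply: time_bind; first exact: time_tmin.
apply: time_bind; first exact: time_tmax.
apply: time_bind; first exact: time_tmin.
apply: time_bind; first exact: time_tmax.
do 4![apply: time_bind; first exact: time_tcount].
by rewrite /=; do 4?case: ifP => //= _.
Qed.

Lemma result_partition_node s (f : 'I_n -> R) c :
  result (partition_node [seq (j, f j) | j <- s] c) =
  ([seq j <- s | f j < c], [seq j <- s | c <= f j]).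
Proof.
by rewrite /partition_node /= !result_tmap !result_tfilter !filter_map
  -!map_comp !map_id.
Qed.

Lemma time_partition_node (fs : seq ('I_n * R)) c :
  (time (partition_node fs c) <= 4 + 10 * size fs)%N.
Proof.
set k := size fs.
apply: (@leq_trans ((1 + 3 * k) + ((1 + 3 * k) +
  ((1 + 2 * k) + ((1 + 2 * k) + 0))))%N); last by lia.
apply: time_bind; first exact: time_tfilter.
apply: time_bind; first exact: time_tfilter.
apply: time_bind.
  by apply: time_tmap; rewrite // result_tfilter size_filter count_size.
apply: time_bind => //.
by apply: time_tmap; rewrite // result_tfilter size_filter count_size.
Qed.

(** * The recursion over the levels *)

(** An empty list of labels is constant, hence a leaf. *)
Lemma size_branching s : ~~ is_leaf P p s -> (0 < size s)%N.
Proof. by case: s. Qed.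

Lemma result_build_from d s :
  result (build_from P X p d s) = lht_from P X p d s.
Proof.
elim: d s => [//|d IHd] s; rewrite [build_from _ _ _ _ _]/= [RHS]/=.
case: ifP => // _.
rewrite result_bind result_select_features result_bind result_weighted_sums.
rewrite result_bind result_find_threshold result_bind result_partition_node.
by rewrite /= !IHd.
Qed.

Lemma time_build_from d s : (0 < m)%N ->
  (time (build_from P X p d s) <= 147 * (m * size s * d))%N.
Proof.
move=> m_gt0; elim: d s => [//|d IHd] s; rewrite [build_from _ _ _ _ _]/=.
case: ifP => // /negbT /size_branching s_gt0; set k := size s.
set l := [seq j <- s | FS P X p s j < threshold P X p s].
set r := [seq j <- s | threshold P X p s <= FS P X p s j].
have size_lr : (size l + size r = k)%N.
  rewrite !size_filter /k.
  (* The order is total, so the two tests are complementary and each sample goes to exactly one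
     child. *)
  rewrite -(count_predC (fun j => FS P X p s j < threshold P X p s)).
  by congr addn; apply: eq_count => j /=; rewrite leNgt.
apply: (@leq_trans ((7 + 7 * k + 34 * m + 21 * (m * k)) +
  ((1 + (4 * m + 3) * k) + ((25 + 31 * k) + ((4 + 10 * k) +
  (147 * (m * size l * d) + (147 * (m * size r * d) + 0))))))%N).
  apply: time_bind; first exact: time_select_features.
  rewrite result_select_features; apply: time_bind.
    by apply: time_weighted_sums; rewrite size_map size_selected.
  have fs_k : size [seq (j, FS P X p s j) | j <- s] = k by rewrite size_map.
  rewrite result_weighted_sums; apply: time_bind.
    by rewrite -fs_k; apply: time_find_threshold.
  rewrite result_find_threshold; apply: time_bind.
    by rewrite -fs_k; apply: time_partition_node.
  by rewrite result_partition_node; do 2![apply: time_bind; first exact: IHd].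
(* The split costs [37 + 51 * k + 34 * m + 25 * (m * k)] in all. As [m] and [k] are positive, each
   term is at most its coefficient times [m * k], and the coefficients add up to 147. *)
have k_mk : (k <= m * k)%N by rewrite leq_pmull.
have m_mk : (m <= m * k)%N by rewrite leq_pmulr.
(* One share [m * k] pays for this split; the remaining [d] shares divide exactly between the
   children. *)
have -> : (m * k * d.+1 = m * k + (m * size l * d + m * size r * d))%N.
  by rewrite -size_lr; lia.
lia.
Qed.

End Build.

Theorem theorem2 :
  exists C : nat,
    forall (R : realFieldType) (n m d : nat) (P : lht_params R)
      (X : 'M[R]_(n, m)) (p : 'I_n -> bool),
      (0 < m)%N ->
      0 <= alpha P -> 0 <= beta P <= 1 -> 0 < gamma P -> 0 < delta1 P ->
      result (build P X p d) = lht P X p d /\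
      (time (build P X p d) <= C * (m * n * d))%N.
Proof.
exists 147 => R n m d P X p m_gt0 _ _ _ _; split; first exact: result_build_from.
(* The root holds all samples, so [n] is the size of its list. *)
by rewrite -[X in (_ * X * _)%N](size_enum_ord n); apply: time_build_from.
Qed.
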